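(* Let $G$ be an infinite, connected, locally finite, unimodular quasitransitive graph. The Free Uniform Spanning Forest (FUSF) and the Wired Uniform Spanning Forest (WUSF) of $G$ are weakly insertion tolerant. Moreover, for each of these two forests (with law $\mathbf{P}$), the functions $f=f(\omega,e,x,r)$ witnessing weak insertion tolerance can be taken such that for every nonnegative integer $r$ there exists a $\delta(r)>0$, depending on $r$ but not on $e,x,A$, with the following property: for every edge $e=\{x,y\}\in E(G)$ and every event $A$ with $\mathbf{P}(A)>0$ such that $C_x\neq C_y$ for almost every configuration in $A$, one has $\mathbf{P}(\pi_e^fA)>\delta(r)\,\mathbf{P}(A)$.
   Context: A graph $G$ is quasitransitive if $\mathrm{Aut}(G)$ has finitely many orbits on $V(G)$; it is unimodular if $\mathrm{Aut}(G)$ is a unimodular locally compact group. Uniform spanning forests. Let $G_n\subset G$ be an exhausting sequence of connected finite subgraphs of $G$. Let $\hat G_n$ be obtained from $G_n$ by adding an extra vertex $z_n$ and replacing every edge $\{x,y\}\in E(G)$ with $x\in V(G_n)$, $y\notin V(G_n)$ by a copy of the edge $\{x,z_n\}$ (multiple edges are allowed). Let $T_n$ be a uniformly chosen spanning tree of $G_n$ and $\hat T_n$ a uniformly chosen spanning tree of $\hat G_n$. The weak limits of $T_n$ and of $\hat T_n$ exist (a known result of Pemantle); the limit of $T_n$ is the FUSF of $G$, and the limit of $\hat T_n$ is the WUSF of $G$. $C_x$ denotes the component of the vertex $x$ in the configuration $\omega\in 2^{E(G)}$, and $B(x,r)$ the ball of radius $r$ around $x$ in $G$. For $e\in E(G)$,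 $f\in E(G)\cup\{\emptyset\}$ and $\omega\in 2^{E(G)}$ let $\pi_e^f\omega:=(\omega\cup\{e\})\setminus\{f\}$ (nothing is removed if $f=\emptyset$). For an event $A$ (and $f$ possibly depending on $\omega$) let $\pi_e^fA:=\{\pi_e^f\omega:\omega\in A\}$. Weak insertion tolerance (WIT). A random forest of $G$ with law $\mathbf{P}$ is weakly insertion tolerant if for any edge $e=\{x,y\}\in E(G)$ (with a choice of endpoint $x$), any nonnegative integer $r$, and any configuration $\omega$ such that $x$ and $y$ are in different components, there exists $f=f(\omega,e,x,r)\in E(G)\cup\{\emptyset\}$ such that: for fixed $e,x,r$, $f$ is a measurable function of $\omega$; if $A$ is an event with $\mathbf{P}(A)>0$ and $C_x\neq C_y$ for almost every configuration in $A$, then $\mathbf{P}(\pi_e^fA)>0$; and, almost surely, if $f\neq\emptyset$ then $f$ is an edge in $C_x\cap B(x,r)^c$ (an edge of $C_x$ outside the ball $B(x,r)$). *)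

(* Defs.v *)
From HB Require Import structures.
From mathcomp Require Import all_boot all_order all_algebra.
From mathcomp Require Import finmap.
From mathcomp Require Import all_classical all_reals all_analysis.

Set Implicit Arguments.
Unset Strict Implicit.
Unset Printing Implicit Defensive.

Import Order.TTheory GRing.Theory Num.Theory.
Import numFieldNormedType.Exports.

Local Open Scope classical_set_scope.
Local Open Scope ring_scope.

Definition borel (T : ptopologicalType) : Type := g_sigma_algebraType (@open T).
HB.instance Definition _ (T : ptopologicalType) :=
  Measurable.copy (borel T) (g_sigma_algebraType (@open T)).

(** ** Haar measures

    No regularity is required of a Haar measure: the notion is only applied to
    automorphism groups of connected locally finite graphs, which are second
    countable, so that every Borel measure that is finite on compact sets is
    regular. *)

Definition left_haar (R : realType) (T : ptopologicalType) (op : T -> T -> T)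
    (mu : {measure set (borel T) -> \bar R}) : Prop :=
  [/\ mu setT != 0%E,
      forall K : set T, compact K -> (mu K < +oo)%E
    & forall (g : T) (A : set (borel T)), measurable A ->
        mu [set op g h | h in A] = mu A].

Definition right_invariant (R : realType) (T : ptopologicalType)
    (op : T -> T -> T) (mu : {measure set (borel T) -> \bar R}) : Prop :=
  forall (g : T) (A : set (borel T)), measurable A ->
    mu [set op h g | h in A] = mu A.

(** ** Walks and spanning trees in multigraphs

    A multigraph with vertices in [W] and edges in [E] is given by a predicate
    [joins]: [joins e x y] means that the endpoints of [e] are [x] and [y]. *)

Section Walks.
Variables (W E : choiceType) (joins : E -> W -> W -> Prop).

(* Each entry of [s] records the edge that is traversed and the vertex that is
   reached; only edges of [T] may be used. *)
Fixpoint walk (T : set E) (x : W) (s : seq (E * W)) : Prop :=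
  if s is (e, y) :: s' then [/\ T e, joins e x y & walk T y s'] else True.

Definition walk_end (x : W) (s : seq (E * W)) : W := last x (map snd s).

Definition linked (T : set E) (x y : W) : Prop :=
  exists2 s, walk T x s & walk_end x s = y.

(* Since the edges, too, must be distinct, going back and forth along an edge is
   not a cycle, but two parallel edges form one. *)
Definition cycle_at (T : set E) (x : W) (s : seq (E * W)) : Prop :=
  [/\ s != [::], walk T x s, walk_end x s = x,
      uniq (map fst s) & uniq (map snd s)].

Definition spanning_tree (VS : set W) (ES T : set E) : Prop :=
  [/\ T `<=` ES,
      forall x y, VS x -> VS y -> linked T x y
    & forall x s, ~ cycle_at T x s].

End Walks.

(** ** Graphs *)

Record sgraph := SGraph {
  vertex :> choiceType;
  adj : rel vertex;
  adj_sym : symmetric adj;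
  adj_irrefl : irreflexive adj }.

Section Graphs.
Variable G : sgraph.

Definition edge : choiceType :=
  set_type [set e : {fset G} | exists x y, adj x y /\ e = [fset x; y]%fset].

Definition ends (e : edge) (x y : G) : Prop := val e = [fset x; y]%fset.

Definition infinite_graph : Prop := infinite_set [set: G].

Definition connected_graph : Prop := forall x y, linked ends setT x y.

Definition locally_finite : Prop := forall x : G, finite_set [set y | adj x y].

Definition gball (x : G) (r : nat) : set G :=
  [set y | exists s,
     [/\ walk ends setT x s, walk_end x s = y & (size s <= r)%N]].

(** ** The automorphism group *)

Definition automorphism : set (G -> G) :=
  [set g | bijective g /\ forall x y, adj (g x) (g y) = adj x y].

(* [Aut(G)] carries the topology of pointwise convergence, where the set of
   vertices is discrete. *)
Definition aut : Type :=
  set_type (automorphism : set {ptws G -> discrete_topology G}).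

HB.instance Definition _ := Topological.on aut.

Lemma automorphism_id : automorphism id.
Proof. by split=> //; exists id. Qed.

Lemma automorphism_comp (g h : G -> G) :
  automorphism g -> automorphism h -> automorphism (g \o h).
Proof.
move=> [bg ag] [bh ah]; split; first exact: bij_comp.
by move=> x y /=; rewrite ag ah.
Qed.

HB.instance Definition _ :=
  isPointed.Build aut (SigSub (mem_set automorphism_id)).

Definition aut_comp (g h : aut) : aut :=
  SigSub (mem_set (automorphism_comp (set_mem (valP g)) (set_mem (valP h)))).

Definition aut_orbit (x : G) : set G := [set g x | g in automorphism].

Definition quasitransitive : Prop := finite_set (range aut_orbit).

Definition unimodular (R : realType) : Prop :=
  exists2 mu : {measure set (borel aut) -> \bar R},
    left_haar aut_comp mu & right_invariant aut_comp mu.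

(** ** Configurations *)

(* [2^E(G)] with the product topology; [w e] means that [e] belongs to [w]. *)
Definition config : Type := {ptws edge -> bool}.

HB.instance Definition _ := Topological.on config.
HB.instance Definition _ := Pointed.on config.

Definition component (w : config) (x : G) : set G :=
  [set y | linked ends [set e | w e] x y].

Definition ins_del (e : edge) (f : option edge) (w : config) : config :=
  fun e' => (w e' || (e' == e)) && (Some e' != f).

(** ** Uniform spanning forests *)

Record subgraph := Subgraph { sub_verts : set G; sub_edges : set edge }.

Definition finite_connected_subgraph (H : subgraph) : Prop :=
  [/\ finite_set (sub_verts H),
      sub_verts H !=set0,
      forall e x y, sub_edges H e -> ends e x y -> sub_verts H x
    & forall x y, sub_verts H x -> sub_verts H y ->
        linked ends (sub_edges H) x y].

Definition exhaustion (H : nat -> subgraph) : Prop :=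
  [/\ forall n, finite_connected_subgraph (H n),
      forall n, sub_verts (H n) `<=` sub_verts (H n.+1) /\
                sub_edges (H n) `<=` sub_edges (H n.+1),
      \bigcup_n sub_verts (H n) = setT
    & \bigcup_n sub_edges (H n) = setT].

Definition free_trees (H : subgraph) : set config :=
  [set w | spanning_tree ends (sub_verts H) (sub_edges H) [set e | w e]].

(* The wired graph has vertices in [option G], where [None] is the additional
   vertex. Its edges are identified with edges of [G]: those of [H], and those
   with exactly one endpoint in [H], whose other endpoint becomes [None]. *)
Definition wire (H : subgraph) (x : G) : option G :=
  if x \in sub_verts H then Some x else None.

Definition wired_ends (H : subgraph) (e : edge) (u v : option G) : Prop :=
  exists x y, [/\ ends e x y, u = wire H x & v = wire H y].

Definition wired_verts (H : subgraph) : set (option G) :=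
  [set Some x | x in sub_verts H] `|` [set None].

Definition wired_edges (H : subgraph) : set edge :=
  sub_edges H `|`
  [set e | exists x y, [/\ ends e x y, sub_verts H x & ~ sub_verts H y]].

Definition wired_trees (H : subgraph) : set config :=
  [set w | spanning_tree (wired_ends H) (wired_verts H) (wired_edges H)
             [set e | w e]].

Section Laws.
Variable R : realType.

(* The expectation of [g] under the uniform distribution on the finite set [S] *)
Definition uniform_mean (S : set config) (g : config -> R) : R :=
  (\sum_(w \in S) g w) / (#|` fset_set S|)%:R.

(* Weak convergence to [P] of the uniform distributions on the sets [S n] *)
Definition uniform_weak_limit (S : nat -> set config)
    (P : probability (borel config) R) : Prop :=
  forall g : config -> R, continuous g ->
    (exists M : R, forall w, `|g w| <= M) ->
    (uniform_mean (S n) g)%:E @[n --> \oo] --> (\int[P]_w (g w)%:E)%E.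

(* The limits do not depend on the exhaustion. *)
Definition is_FUSF (P : probability (borel config) R) : Prop :=
  exists2 H, exhaustion H & uniform_weak_limit (free_trees \o H) P.

Definition is_WUSF (P : probability (borel config) R) : Prop :=
  exists2 H, exhaustion H & uniform_weak_limit (wired_trees \o H) P.

(** ** Weak insertion tolerance *)

Definition ins_del_event (e : edge) (f : config -> option edge)
    (A : set (borel config)) : set (borel config) :=
  [set ins_del e (f w) w | w in A].

Definition edge_of_component_outside (w : config) (x : G) (r : nat) (e : edge) :
    Prop :=
  w e /\ forall v, v \in val e -> component w x v /\ ~ gball x r v.

(* [f e x r] is the choice function for the edge [e], its endpoint [x] and the
   radius [r]; its values when [x] is not an endpoint of [e] are irrelevant. On
   the configurations for which the endpoints of [e] are in the same component,
   it may take the value [None]. *)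
Definition WIT_witness (P : probability (borel config) R)
    (f : edge -> G -> nat -> config -> option edge) : Prop :=
  forall (e : edge) (x y : G) (r : nat), ends e x y ->
  [/\ forall h : option edge,
        measurable ([set w | f e x r w = h] : set (borel config)),
      forall A : set (borel config), measurable A -> (0 < P A)%E ->
        {ae P, forall w, A w -> component w x <> component w y} ->
        (0 < P (ins_del_event e (f e x r) A))%E
    & {ae P, forall w, forall h, f e x r w = Some h ->
        edge_of_component_outside w x r h}].

Definition weakly_insertion_tolerant (P : probability (borel config) R) : Prop :=
  exists f, WIT_witness P f.

End Laws.
End Graphs.

(* Main.v *)
Require Import Defs.
From HB Require Import structures.
From mathcomp Require Import all_boot all_order all_algebra.
From mathcomp Require Import finmap.
From mathcomp Require Import all_classical all_reals all_analysis.

Set Implicit Arguments.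
Unset Strict Implicit.
Unset Printing Implicit Defensive.

Import Order.TTheory GRing.Theory Num.Theory.
Import numFieldNormedType.Exports.

Local Open Scope classical_set_scope.
Local Open Scope ring_scope.

(** Let [B] be the ball of radius [r + 1] around [x], and let [D] be the event
    that [x] and [y] are joined inside [B]. In a spanning tree (of a large finite
    free or wired subgraph) outside [D], the path from [x] to [y] leaves [B]
    through an edge [h], and exchanging [h] for [e] yields a spanning tree. For
    fixed [h] the exchange is injective, so by counting trees and taking weak
    limits, [P (A \ D) <= \sum_h nu_h A] for every cylinder [A], where [nu_h A] is
    the probability of the exchanged configurations, and [h] ranges over the [K]
    or fewer edges that touch [B]; by monotone classes this holds for all Borel
    sets [A]. Choose [f w] as the first [h] such that [nu_h] has density at least
    [1 / (K + 1)] at [w] (Hahn decomposition); such an [h] exists for almost all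
    [w] outside [D]. Hence some image has probability at least
    [P A / (K (K + 1))], and quasitransitivity bounds [K] in terms of [r]. *)

(** * Walks, bridges and edge exchange in multigraphs *)

Section Walks.
Variables (W E : choiceType) (J : E -> W -> W -> Prop).
Hypothesis Jsym : forall e u v, J e u v -> J e v u.
Hypothesis Jends : forall e u v u' v', J e u v -> J e u' v' ->
  (u = u' /\ v = v') \/ (u = v' /\ v = u').
Implicit Types (S T : set E) (u v w : W).

Lemma linked_refl T u : linked J T u u.
Proof. by exists [::]. Qed.

Lemma linked_trans T v u w : linked J T u v -> linked J T v w -> linked J T u w.
Proof.
move=> [s ws sv] [t wt <-]; elim: s u ws sv => [|[e z] s IHs] u /=.
  by move=> _ uv; rewrite -uv in wt *; exists t.
move=> [Te Je ws] sv; have [s' ws' <-] := IHs _ ws sv.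
by exists ((e, z) :: s').
Qed.

Lemma linked1 T e u v : T e -> J e u v -> linked J T u v.
Proof. by move=> Te Je; exists [:: (e, v)]. Qed.

Lemma linked_ind T (P : W -> W -> Prop) :
  (forall u, P u u) -> (forall u v w, P u v -> P v w -> P u w) ->
  (forall e u v, T e -> J e u v -> P u v) ->
  forall u v, linked J T u v -> P u v.
Proof.
move=> P0 Ptr P1 u v [s + <-]; elim: s u => [|[e z] s IHs] u //= [Te Je ws].
exact: Ptr (P1 _ _ _ Te Je) (IHs _ ws).
Qed.

Lemma linked_sym T u v : linked J T u v -> linked J T v u.
Proof.
apply: (linked_ind (P := fun u v => linked J T v u)).
- exact: linked_refl.
- by move=> a b c ba cb; exact: linked_trans cb ba.
- by move=> e a b Te Je; exact: linked1 Te (Jsym Je).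
Qed.

Lemma sub_linked S T u v : S `<=` T -> linked J S u v -> linked J T u v.
Proof.
move=> ST; apply: linked_ind; first exact: linked_refl.
- by move=> a0 b0 c0; exact: linked_trans.
- by move=> e a b /ST; exact: linked1.
Qed.

Lemma walk_catE T u s t :
  walk J T u (s ++ t) <-> walk J T u s /\ walk J T (walk_end u s) t.
Proof.
elim: s u => [|[e z] s IHs] u /=; first by split => // -[].
split=> [[Te Je /IHs[ws wt]]|[[Te Je ws] wt]]; first by split.
by split=> //; apply/IHs; split.
Qed.

(** Loop erasure by induction on the length: if the start [u] recurs on the simple walk found for
    the tail, only the part after that recurrence is kept. *)
Lemma linked_uniq T u v : linked J T u v ->
  exists s, [/\ walk J T u s, walk_end u s = v & uniq (u :: map snd s)].
Proof.
move=> [s]; have [n] := ubnP (size s).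
elim: n s u => // n IHn [|[e z] s] u /= sn.
  by move=> _ <-; exists [::].
move=> [Te Je ws] sv; have [t [wt tv ut]] := IHn _ _ sn ws sv.
have [uin|unin] := boolP (u \in z :: map snd t); last first.
  by exists ((e, z) :: t); split=> //=; rewrite unin; exact: ut.
move: uin; rewrite inE => /orP[/eqP->|]; first by exists t.
move=> /mapP[[g y] gin /= uy]; case: (path.splitPr gin) wt tv ut => t1 t2.
move=> /walk_catE[_ /= [_ _ w2]] tv ut; exists t2; split.
- by rewrite uy.
- by rewrite -tv uy /walk_end map_cat last_cat /=.
- by move: ut; rewrite /= map_cat cat_uniq /= uy => /and4P[_ _ _].
Qed.

Lemma walk_edge_end T u s e : walk J T u s -> e \in map fst s ->
  exists p q, [/\ J e p q, p \in u :: map snd s & q \in u :: map snd s].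
Proof.
elim: s u => [|[g z] s IHs] u //= [_ Jg ws].
rewrite inE => /orP[/eqP->|es].
  by exists u, z; rewrite !inE !eqxx orbT.
have [p [q [Je ps qs]]] := IHs _ ws es.
by exists p, q; split; rewrite // inE; apply/orP; right.
Qed.

Lemma walk_notin T u w e z s : J e u z -> u \notin w :: map snd s ->
  walk J T w s -> e \notin map fst s.
Proof.
move=> Je uns ws; apply/negP => /(walk_edge_end ws)[p [q [Jpq ps qs]]].
by have [[up _]|[uq _]] := Jends Je Jpq; move: uns; rewrite ?up ?uq ?ps ?qs.
Qed.

Lemma walk_uniq_edges T u s :
  walk J T u s -> uniq (u :: map snd s) -> uniq (map fst s).
Proof.
elim: s u => [|[e z] s IHs] u //= [_ Je ws] /andP[us uz].
by rewrite (IHs _ ws uz) (walk_notin Je us ws).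
Qed.

Lemma walkD1 T u s e : walk J T u s -> e \notin map fst s ->
  walk J (T `\ e) u s.
Proof.
elim: s u => [|[g z] s IHs] u //= [Tg Jg ws]; rewrite inE negb_or.
by move=> /andP[/eqP eg es]; split; [split=> // /esym| |exact: IHs].
Qed.

Lemma sub_walk S T u s : S `<=` T -> walk J S u s -> walk J T u s.
Proof.
by move=> ST; elim: s u => [|[g z] s IHs] u //= [/ST Tg Jg /IHs].
Qed.

(** Acyclicity stated edge by edge; in this form it is easy to follow under deletion and insertion
    of single edges. *)
Definition all_bridges T :=
  forall e u v, T e -> J e u v -> ~ linked J (T `\ e) u v.

(** If the endpoints of [e] stay linked without [e], a simple walk between them is closed by [e] to
    a cycle. Conversely, the rest of a cycle bypasses its first edge. *)
Lemma acyclicP T : (forall u s, ~ cycle_at J T u s) <-> all_bridges T.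
Proof.
split=> [acy e u v Te Je /linked_sym/linked_uniq[s [ws sv us]]|br u s].
  have ws' := sub_walk (@subDsetl _ _ _) ws.
  apply: (acy u ((e, v) :: s)); split => //=.
  rewrite (walk_uniq_edges ws us) andbT; apply/negP => es.
  have {}ws : walk J (T `\ e) v s by [].
  elim: s v ws es {sv us ws' Je} => [|[g z] s IHs] v //= [[_ ge] _ ws].
  by rewrite inE => /orP[/eqP/esym//|]; exact: IHs ws.
case: s => [|[e v] s] [] //= _ [Te Je ws] sv /andP[es _] _.
apply: (br e u v Te Je); apply: linked_sym.
by exists s => //; exact: walkD1.
Qed.

Lemma sub_bridges S T : S `<=` T -> all_bridges T -> all_bridges S.
Proof.
move=> ST br e u v Se Je l; apply: (br e u v (ST _ Se) Je).
by apply: sub_linked l => g [/ST].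
Qed.

(** A walk can be shortened until it uses [e] at most once: a second passage makes one of the two
    endpoints of [e] reachable on both sides without the detour. The cases are no passage, and one
    passage in either direction. *)
Lemma linkedU1 S e x y u v : J e x y -> linked J (S `|` [set e]) u v ->
  linked J S u v \/ (linked J S u x /\ linked J S y v) \/
  (linked J S u y /\ linked J S x v).
Proof.
move=> Je; move=> [s + <-]; elim: s u => [|[g z] s IHs] u.
  by left; exact: linked_refl.
move=> /= [Sg Jg ws]; have := IHs _ ws; rewrite -/(walk_end z s).
case: Sg => [Sg|/= ge].
  have uz := linked1 Sg Jg.
  case=> [|[|]]; first by left; exact: linked_trans uz _.
    by move=> [zx yv]; right; left; split=> //; exact: linked_trans uz zx.
  by move=> [zx yv]; right; right; split=> //; exact: linked_trans uz zx.
rewrite {}ge in Jg; case: (Jends Jg Je) => -[-> ->].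
- case=> [yv|[[yx yv]|[_ xv]]].
  + by right; left; split; first exact: linked_refl.
  + by right; left; split; first exact: linked_refl.
  + by left.
- case=> [yv|[[yx yv]|[_ xv]]].
  + by right; right; split; first exact: linked_refl.
  + by left.
  + by right; right; split; first exact: linked_refl.
Qed.

(** If an old edge [g] had a bypass, the bypass would have to use [e]; its two remaining pieces
    together with [g] would then link [x] to [y] inside [S]. *)
Lemma bridgesU1 S e x y : J e x y -> all_bridges S -> ~ linked J S x y ->
  all_bridges (S `|` [set e]).
Proof.
move=> Je br nxy g c d Sg Jg.

have [ge|/eqP ge] := eqVneq g e.
  have SS : (S `|` [set e]) `\ g `<=` S by move=> f /= [[//|->] /(_ (esym ge))].
  move=> /(sub_linked SS) l; rewrite {}ge in Jg.
  by have [[xc yd]|[xd yc]] := Jends Je Jg; apply: nxy; rewrite ?xc ?xd ?yc ?yd;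
    [|exact: linked_sym].
have {}Sg : S g by case: Sg.
have SS : (S `|` [set e]) `\ g `<=` (S `\ g) `|` [set e].
  by move=> f /= [[Sf|->] fg]; [left|right].
have SgS : S `\ g `<=` S by move=> f [].
have cd := linked1 Sg Jg.
move=> /(sub_linked SS)/(linkedU1 Je)[l|[[cx yd]|[cy xd]]].
- exact: (br g c d).
- apply: nxy; apply: linked_trans (sub_linked SgS (linked_sym cx)) _.
  exact: linked_trans cd (sub_linked SgS (linked_sym yd)).
- apply: nxy; apply: linked_trans (sub_linked SgS xd) _.
  exact: linked_trans (linked_sym cd) (sub_linked SgS cy).
Qed.

(** The removed edge [h] is replaced by the detour from [a] to [x], along [e], and from [y] to [b],
    so connectivity survives. If [x] and [y] were linked without [h], so would be [a] and [b],
    against [h] being a bridge; hence [e] closes no cycle. *)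
Lemma spanning_tree_exchange VS ES T e h x y a b :
  spanning_tree J VS ES T -> ES e -> ~ T e -> T h -> J e x y -> J h a b ->
  linked J (T `\ h) x a -> linked J (T `\ h) b y ->
  spanning_tree J VS ES ((T `|` [set e]) `\ h).
Proof.
move=> [TES conn /acyclicP br] ESe nTe Th Je Jh xa by_.
have TT : T `\ h `<=` (T `|` [set e]) `\ h by move=> f [Tf fh]; split; [left|].
have ab : linked J ((T `|` [set e]) `\ h) a b.
  apply: linked_trans (sub_linked TT (linked_sym xa)) _.
  apply: linked_trans _ (sub_linked TT (linked_sym by_)).
  by apply: linked1 Je; split=> [|/= eh]; [right|rewrite eh in nTe].
split.
- by move=> f [[/TES//|->]].
- move=> u v uV vV; apply: (linked_ind _ _ _ (conn u v uV vV)).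
  + exact: linked_refl.
  + by move=> a0 b0 c0; exact: linked_trans.
  + move=> f c d Tf Jf; have [fh|/eqP fh] := eqVneq f h.
      rewrite fh in Jf; case: (Jends Jf Jh) => -[-> ->] //.
      exact: linked_sym.
    by apply: linked1 Jf; apply: TT.
- apply/acyclicP.
  have TT' : (T `|` [set e]) `\ h `<=` (T `\ h) `|` [set e].
    by move=> f [[Tf|->] fh]; [left|right].
  apply: (sub_bridges TT'); apply: (bridgesU1 Je); first exact: sub_bridges br.
  move=> xy; apply: (br h a b Th Jh); apply: linked_trans (linked_sym xa) _.
  exact: linked_trans xy (linked_sym by_).
Qed.

(** In the second alternative [h] is the first edge that leaves [B]. The walk does not use it again:
    before, it stays in [B], which misses [b]; afterwards it never returns to [a], being simple. *)
Lemma walk_exit T (B : W -> Prop) x s : walk J T x s ->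
  uniq (x :: map snd s) -> B x ->
  (walk J T x s /\ forall u, u \in x :: map snd s -> B u) \/
  exists h a b,
    [/\ T h, J h a b, B a, ~ B b & linked J (T `\ h) b (walk_end x s)] /\
    exists s1, [/\ walk J (T `\ h) x s1, walk_end x s1 = a &
      forall u, u \in x :: map snd s1 -> B u].
Proof.
elim: s x => [|[e z] s IHs] x.
  by move=> _ _ Bx; left; split=> // u; rewrite inE => /eqP ->.
move=> ws us Bx; have [Te Je wz] := ws.
have /andP[xs uz] : (x \notin z :: map snd s) && uniq (z :: map snd s) by [].
have [Bz|nBz] := pselect (B z); last first.
  right; exists e, x, z; split.
    split=> //; exists s => //; apply: (walkD1 wz); apply: walk_notin Je xs wz.
  by exists [::]; split=> // u; rewrite inE => /eqP ->.
have [[_ Bs]|] := IHs z wz uz Bz.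
  by left; split=> // u; rewrite inE => /orP[/eqP ->//|]; exact: Bs.
move=> [h [a [b [[Th Jh Ba nBb bl] [s1 [w1 e1 B1]]]]]].
right; exists h, a, b; split=> //.
exists ((e, z) :: s1); split=> //.
  split=> //; split=> //= eh; rewrite eh in Je.
  by have [[_ zb]|[xb _]] := Jends Je Jh; apply: nBb; rewrite -?zb -?xb.
by move=> u; rewrite inE => /orP[/eqP ->//|]; exact: B1.
Qed.

End Walks.

(** * Projected graphs and connections inside a set of vertices *)

Section LocalConnections.
Variable G : sgraph.
Implicit Types (B : set G) (w : config G) (e h : edge G) (x y a b u v : G).

Lemma ends_sym e u v : ends e u v -> ends e v u.
Proof. by rewrite /ends fsetUC. Qed.

Lemma ends_uniq e u v u' v' : ends e u v -> ends e u' v' ->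
  (u = u' /\ v = v') \/ (u = v' /\ v = u').
Proof.
rewrite /ends => -> /fsetP E.
have in2 p q z : z \in [fset p; q]%fset -> z = p \/ z = q.
  by rewrite !inE => /orP[]/eqP; auto.
have [uE vE] : (u = u' \/ u = v') /\ (v = u' \/ v = v').
  by split; apply: in2; rewrite -E !inE eqxx ?orbT.
have [uE' vE'] : (u' = u \/ u' = v) /\ (v' = u \/ v' = v).
  by split; apply: in2; rewrite E !inE eqxx ?orbT.
by case: uE vE uE' vE' => -> [->|->] [] ? [] ?; auto.
Qed.

(** The multigraph obtained by identifying vertices of [G] along [i]. The map [id] gives [ends] and
    [wire H] gives [wired_ends H], so that the free and the wired case are treated at once. *)
Definition proj_ends (W : choiceType) (i : G -> W) e (p q : W) :=
  exists x y, [/\ ends e x y, p = i x & q = i y].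

Lemma proj_ends_sym (W : choiceType) (i : G -> W) e (p q : W) :
  proj_ends i e p q -> proj_ends i e q p.
Proof. by move=> [x [y [xy -> ->]]]; exists y, x; split=> //; exact: ends_sym. Qed.

Lemma proj_ends_uniq (W : choiceType) (i : G -> W) e (p q p' q' : W) :
  proj_ends i e p q -> proj_ends i e p' q' ->
  (p = p' /\ q = q') \/ (p = q' /\ q = p').
Proof.
move=> [x [y [xy -> ->]]] [x' [y' [xy' -> ->]]].
by have [[-> ->]|[-> ->]] := ends_uniq xy xy'; auto.
Qed.

Lemma proj_ends_id : proj_ends id = @ends G.
Proof.
apply/funext => e; apply/funext => u; apply/funext => v; apply/propext.
by split=> [[x [y [xy -> ->]]]|uv] //; exists u, v.
Qed.

Definition inside B w : set (edge G) :=
  [set g | w g /\ forall v, v \in val g -> B v].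

Definition inside_linked B w x y : Prop := linked (@ends G) (inside B w) x y.

Definition exits B e x h : set (config G) :=
  [set w : config G | ~ w e /\ w h /\
    exists a b, [/\ ends h a b, B a, ~ B b & inside_linked B w x a]].

Lemma inside_linked_component B w x y :
  inside_linked B w x y -> component w x = component w y.
Proof.
move=> l; have {}l : linked (@ends G) [set g | w g] x y.
  by apply: sub_linked l => g [].
apply/seteqP; split=> z; rewrite /component /=; last exact: linked_trans l.
exact: linked_trans (linked_sym ends_sym l).
Qed.

Lemma val_ends e u v : ends e u v -> forall z, z \in val e -> z = u \/ z = v.
Proof. by rewrite /ends => -> z; rewrite !inE => /orP[]/eqP ->; auto. Qed.

(* Exchanging [e] for the first edge of the tree path from [x] to [y] that
   leaves [B]. *)
Lemma tree_exit (W : choiceType) (i : G -> W) VS ES B e x y w :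
  (forall u v, B u -> i u = i v -> u = v) ->
  VS (i x) -> VS (i y) -> ends e x y -> ES e -> B x -> B y ->
  spanning_tree (proj_ends i) VS ES [set g | w g] ->
  ~ inside_linked B w x y ->
  exists h, exits B e x h w /\
    spanning_tree (proj_ends i) VS ES [set g | ins_del e (Some h) w g].
Proof.
move=> iB xVS yVS exy ESe Bx By tw nxy.
have nwe : ~ w e.
  move=> we; apply: nxy; apply: (linked1 _ exy); split=> // v.
  by move=> /(val_ends exy)[]->.
(* By [iB], a vertex of [B] is identified with no other vertex, so a projected walk that stays in
   the image of [B] comes from a walk inside [B]. *)
have lift u s : B u -> walk (proj_ends i) [set g | w g] (i u) s ->
    (forall p : W, p \in i u :: map snd s -> (i @` B) p) ->
    exists2 u', walk_end (i u) s = i u' & inside_linked B w u u'.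
  elim: s u => [|[g z] s IHs] u Bu /=.
    by move=> _ _; exists u => //; exact: linked_refl.
  move=> [wg [u1 [z1 [guz /(iB _ _ Bu) uu1 zz1]]] ws] Bs.
  have [|z2 Bz2 zE] := Bs z; first by rewrite !inE eqxx orbT.
  have z12 : z2 = z1 by apply: iB => //; rewrite zE.
  subst z u1 z2.
  have [|u' sE l] := IHs z1 Bz2 ws.
    by move=> v vs; apply: Bs; rewrite inE vs orbT.
  exists u' => //; apply: linked_trans l; apply: (linked1 _ guz); split=> // v.
  by move=> /(val_ends guz)[]->.
have [_ conn _] := tw.
have Jsym := @proj_ends_sym W i; have Jends := @proj_ends_uniq W i.
have [s [ws sy us]] := linked_uniq (conn _ _ xVS yVS).
have iBx : (i @` B) (i x) by exists x.
have [[_ Bs]|] := walk_exit Jends ws us iBx.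
  have [y' + l] := lift x s Bx ws Bs.
  by rewrite sy => /(iB _ _ By) yy'; case: nxy; rewrite yy'.
move=> [h [a [b [[wh Jh [a1 Ba1 aE] nBb bl] [s1 [ws1 sa1 Bs1]]]]]].
have ws1' := sub_walk (@subDsetl _ _ _) ws1.
have [a2] := lift x s1 Bx ws1' Bs1; rewrite sa1 -aE => /(iB _ _ Ba1) <- l.
have [u [v [huv au bv]]] := Jh.
have a1u : a1 = u by apply: iB => //; rewrite aE.
subst a1; exists h; split.
  split=> //; split=> //; exists u, v; split=> // Bv.
  by apply: nBb; exists v.
have -> : [set g | ins_del e (Some h) w g] = ([set g | w g] `|` [set e]) `\ h.
  apply/seteqP; split=> g; rewrite /ins_del /=.
    move=> /andP[/orP[wg|/eqP ->] /eqP gh].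
      by split=> [|E]; [left|apply: gh; rewrite E].
    by split=> [|E]; [right|apply: gh; rewrite E].
  move=> [[wg|->] gh]; apply/andP; (split; last by apply/eqP => -[]).
    by rewrite wg.
  by rewrite eqxx orbT.
apply: (spanning_tree_exchange Jsym Jends tw ESe nwe wh _ Jh).
- by exists x, y; split.
- by exists s1.
- by rewrite sy in bl.
Qed.

End LocalConnections.

(** * Bounds on balls that are uniform in the centre *)

Section UniformBounds.
Variable G : sgraph.
Implicit Types (x y a b : G) (h : edge G).

Lemma gballS x r a b h : gball x r a -> ends h a b -> gball x r.+1 b.
Proof.
move=> [s [ws sa sr]] hab; exists (rcons s (h, b)); split.
- rewrite -cats1; apply/walk_catE; split=> //=; split=> //.
  by rewrite /walk_end in sa; rewrite /walk_end sa.
- by rewrite /walk_end map_rcons last_rcons.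
- by rewrite size_rcons.
Qed.

Lemma sub_gballS x r : gball x r `<=` gball x r.+1.
Proof. by move=> y [s [ws sy sr]]; exists s; split=> //; exact: leqW. Qed.

Lemma gball_center x r : gball x r x.
Proof. by exists [::]. Qed.

Lemma ends_adj h a b : ends h a b -> adj a b.
Proof.
move=> hab; have [u [v [uv uvh]]] := set_mem (valP h).
by have [[-> ->]|[-> ->]] := ends_uniq hab uvh; rewrite // adj_sym.
Qed.

(** Automorphisms carry neighbours to neighbours, so a degree bound holds on a whole orbit; the
    maximum over the finitely many orbits serves for all vertices. *)
Lemma quasitransitive_degree (Glf : locally_finite G) (Gqt : quasitransitive G) :
  exists (d : nat) (nbr : G -> seq G),
    forall x, (size (nbr x) <= d)%N /\ forall y, adj x y -> y \in nbr x.
Proof.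
pose D n x := exists s : seq G, (size s <= n)%N /\ forall y, adj x y -> y \in s.
have Dfin x : exists n, D n x.
  have fx := Glf x; exists (size (fset_set [set y | adj x y])).
  exists (fset_set [set y | adj x y]); split=> // y xy.
  by rewrite in_fset_set // inE.
have Daut n x y : aut_orbit x y -> D n x -> D n y.
  move=> [g [[g' gK g'K] ag] <-] [s [sn xs]].
  exists (map g s); split=> [|z]; first by rewrite size_map.
  by rewrite -(g'K z) ag => /xs; exact: map_f.
(* The default 0 never matters on an orbit, since a bound exists there. *)
pose deg (O : set G) := xget 0%N [set n | forall x, O = aut_orbit x -> D n x].
have degP x : D (deg (aut_orbit x)) x.
  have [n Dn] := Dfin x.
  suff /(xgetPex 0%N) H :
      exists m, [set n | forall y, aut_orbit x = aut_orbit y -> D n y] m.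
    exact: H.
  exists n => y xy; apply: Daut Dn; rewrite xy.
  by exists id => //; exact: automorphism_id.
have fdeg : finite_set (deg @` range (@aut_orbit G)) by exact: finite_image.
pose d := \max_(n <- fset_set (deg @` range (@aut_orbit G))) n.
have Dd x : D d x.
  have [s [sn xs]] := degP x; exists s; split=> //; apply: leq_trans sn _.
  apply: (@leq_bigmax_seq _ _ predT id) => //.
  rewrite in_fset_set // inE; exists (aut_orbit x) => //; exists x => //.
by have [nbr] := choice Dd; exists d, nbr.
Qed.

Lemma gball_bound (Glf : locally_finite G) (Gqt : quasitransitive G) :
  exists K : nat -> nat, forall r x, exists (bs : seq G) (es : seq (edge G)),
    [/\ (size es <= K r)%N, forall a, gball x r a -> a \in bs &
      forall a b h, gball x r a -> ends h a b -> h \in es].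
Proof.
have [d [nbr nbrP]] := quasitransitive_degree Glf Gqt.
(* Oriented edges out of [s]. The lists [nbr a] may contain vertices that are not adjacent to [a];
   [insub] below discards the pairs that are not edges. *)
pose N (s : seq G) := [seq (a, b) | a <- s, b <- nbr a].
pose ball r x := iter r (fun s => s ++ map snd (N s)) [:: x].
pose size_ball r := iter r (fun n => n + n * d)%N 1%N.
have sizeN s n : (size s <= n)%N -> (size (N s) <= n * d)%N.
  elim: s n => [|a s IHs] [|n] //= sn; rewrite size_cat mulSn size_map.
  by rewrite leq_add ?IHs ?(nbrP a).1.
have size_ballP r x : (size (ball r x) <= size_ball r)%N.
  by elim: r => // r IHr; rewrite /= size_cat size_map leq_add ?sizeN.
have NP s a b : a \in s -> adj a b -> (a, b) \in N s.
  by move=> as_ ab; apply/allpairsPdep; exists a, b; split=> //; exact: (nbrP a).2.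
have ballP r x a : gball x r a -> a \in ball r x.
  elim: r a => [|r IHr] a [s [ws <- sr]].
    by move: sr; rewrite leqn0 size_eq0 => /eqP ->; rewrite inE.
  rewrite /= mem_cat.
  elim/last_ind: s sr ws => [|s [h b] _].
    by move=> _ _; rewrite IHr //; exists [::].
  rewrite size_rcons -cats1 => sr /walk_catE[ws /= [_ hb _]].
  apply/orP; right; apply/mapP; exists (walk_end x s, b).
    by apply: NP; [apply: IHr; exists s|exact: ends_adj hb].
  by rewrite /walk_end map_cat last_cat.
exists (fun r => size_ball r * d)%N => r x.
exists (ball r x), (pmap (fun p : G * G => insub [fset p.1; p.2]%fset) (N (ball r x))).
split=> [|a|a b h xa hab]; last 2 first.
- exact: ballP.
- rewrite mem_pmap; apply/mapP; exists (a, b).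
    by apply: NP; [exact: ballP|exact: ends_adj hab].
  by rewrite /= -hab valK.
by rewrite size_pmap; apply: leq_trans (count_size _ _) _; exact: sizeN.
Qed.

End UniformBounds.

(** * Cylinder events and the product topology *)

Section CylinderEvents.
Variable G : sgraph.
Implicit Types (w : config G) (e : edge G) (L : seq (edge G)).
Implicit Types (C O : set (config G)).

Definition agree L w w' := forall e, e \in L -> w e = w' e.

Definition determined L C := forall w w', agree L w w' -> C w -> C w'.

Definition cylinder C := exists L, determined L C.

Lemma agree_sym L w w' : agree L w w' -> agree L w' w.
Proof. by move=> ww' e /ww' ->. Qed.

Lemma sub_agree L L' w w' : {subset L <= L'} -> agree L' w w' -> agree L w w'.
Proof. by move=> LL' ww' e /LL'; exact: ww'. Qed.

Lemma agree_trans L w1 w2 w3 : agree L w1 w2 -> agree L w2 w3 -> agree L w1 w3.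
Proof. by move=> w12 w23 e eL; rewrite w12 // w23. Qed.

Lemma sub_determined L L' C : {subset L <= L'} -> determined L C -> determined L' C.
Proof. by move=> LL' LC w w' /(sub_agree LL'); exact: LC. Qed.

Lemma determinedT L : determined L setT. Proof. by []. Qed.

Lemma determinedC L C : determined L C -> determined L (~` C).
Proof. by move=> LC w w' ww' nC /(LC _ _ (agree_sym ww')). Qed.

Lemma determinedI L C C' :
  determined L C -> determined L C' -> determined L (C `&` C').
Proof. by move=> LC LC' w w' ww' [/(LC _ _ ww') ? /(LC' _ _ ww')]. Qed.

Lemma determinedU L C C' :
  determined L C -> determined L C' -> determined L (C `|` C').
Proof.
by move=> LC LC' w w' ww' [/(LC _ _ ww')|/(LC' _ _ ww')]; [left|right].
Qed.

Lemma determinedD L C C' :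
  determined L C -> determined L C' -> determined L (C `\` C').
Proof. by move=> LC LC'; rewrite setDE; apply: determinedI LC (determinedC LC'). Qed.

Lemma determined1 L e (b : bool) : e \in L -> determined L [set w | w e = b].
Proof. by move=> eL w w' ww' /= <-; rewrite ww'. Qed.

Lemma setring_cylinder : setring cylinder.
Proof.
split; first by exists [::].
- move=> C C' [L LC] [L' LC']; exists (L ++ L').
  apply: determinedU.
    by apply: sub_determined LC => e; rewrite mem_cat => ->.
  by apply: sub_determined LC' => e; rewrite mem_cat orbC => ->.
- move=> C C' [L LC] [L' LC']; exists (L ++ L').
  apply: determinedD.
    by apply: sub_determined LC => e; rewrite mem_cat => ->.
  by apply: sub_determined LC' => e; rewrite mem_cat orbC => ->.
Qed.

(** The sets containing some [agree L w] form a filter that converges to [w] in each coordinate,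
    hence in the product topology. Conversely, [agree L w] is a finite intersection of coordinate
    neighbourhoods. *)
Lemma nbhs_configP w O : nbhs w O <-> exists L, agree L w `<=` O.
Proof.
split.
  pose F : set_system (config G) := [set O | exists L, agree L w `<=` O].
  have FF : Filter F.
    split; first by exists [::].
    - move=> A B [L LA] [L' LB]; exists (L ++ L') => w' ww'; split.
        by apply: LA; apply: sub_agree ww' => e; rewrite mem_cat => ->.
      by apply: LB; apply: sub_agree ww' => e; rewrite mem_cat orbC => ->.
    - by move=> A B AB [L LA]; exists L; exact: subset_trans AB.
  suff Fw : F --> w by exact: Fw.
  apply/cvg_sup => e A /=.
  rewrite (@nbhsE (initial_topology (fun w' : config G => w' e))).
  move=> [B [[C oC <-] Cw] BA].
  exists [:: e] => w' ww'; apply: BA; rewrite /= -ww' ?inE //.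
move=> [L]; elim: L O => [|e L IHL] O LO.
  have -> : O = setT by apply/seteqP; split=> // w' _; exact: LO.
  exact: filterT.
have wL : nbhs w (agree L w) by exact: IHL.
have we : nbhs w [set w' | w' e = w e].
  have := @proj_continuous (edge G) (fun=> bool) e w [set w e].
  by apply.
apply: filterS (filterI wL we) => w' [ww' wwe]; apply: LO => g.
by rewrite inE => /orP[/eqP ->//|]; exact: ww'.
Qed.

End CylinderEvents.

(** * Cylinder events generate the Borel sets *)

Section BorelCylinder.
Variable G : sgraph.
Implicit Types (w : config G) (e : edge G) (L : seq (edge G)).
Implicit Types (C O : set (config G)).

Lemma open_cylinder C : cylinder C -> open C.
Proof.
move=> [L LC]; rewrite openE => w Cw; apply/nbhs_configP.
by exists L => w' /LC; exact.
Qed.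

Lemma measurable_cylinder C : cylinder C -> measurable (C : set (borel (config G))).
Proof. by move=> /open_cylinder oC; exact: sub_sigma_algebra. Qed.

(** The indicator is locally constant; this makes it an admissible test function for the weak
    limit. *)
Lemma continuous_indic_cylinder (R : realType) C :
  cylinder C -> continuous (\1_C : config G -> R).
Proof.
move=> [L LC] w; apply/cvgrPdist_lt => eps eps0; apply/nbhs_configP.
exists L => w' ww'; rewrite /= !indicE.
suff -> : (w' \in C) = (w \in C) by rewrite subrr normr0.
apply/idP/idP => /set_mem CC; apply/mem_set; last exact: LC CC.
exact: LC (agree_sym ww') CC.
Qed.

Lemma measurable_ins_del e (f : option (edge G)) :
  measurable_fun setT (ins_del e f : borel (config G) -> borel (config G)).
Proof.
apply: (@measurability _ _ (borel (config G)) (borel (config G)) _ _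
  (@open (config G))) => //.
move=> _ [V oV <-].
rewrite setTI; apply: sub_sigma_algebra.
rewrite /= openE => w /= Vw; have : nbhs (ins_del e f w) V.
  by move: oV; rewrite openE; apply.
move=> /nbhs_configP[L LV]; apply/nbhs_configP; exists L => w' ww'.
by apply: LV => g gL; rewrite /ins_del ww'.
Qed.

(** The monotone class theorem for the ring of cylinders. The sequence [F] expresses that there are
    countably many edges, which makes every open set a countable union of cylinders. *)
Lemma borel_cylinder_ind (F : nat -> seq (edge G)) (M : set (set (config G))) :
  (forall L, exists n, {subset L <= F n}) ->
  monotone M -> (forall C, cylinder C -> M C) ->
  forall A : set (borel (config G)), measurable A -> M A.
Proof.
move=> FL mM CM A mA.
apply: (monotone_setring_sub_g_sigma_ring mM (@setring_cylinder G) CM).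
(* The whole space is a cylinder, so the sigma-ring generated by the cylinders is a sigma-algebra;
   it remains to see that it contains the open sets. *)
have [sr0 srD srU] := smallest_sigma_ring (@cylinder G).
apply: (mA) => /=; split.
  split=> // B srB; apply: srD => //.
  by apply: sub_gen_smallest; exists [::].
move=> O oO.
have -> : O = \bigcup_n [set w | agree (F n) w `<=` O].
  apply/seteqP; split=> w.
    rewrite openE in oO; move=> /oO/nbhs_configP[L LO].
    have [n Fn] := FL L; exists n => // w' /(sub_agree Fn); exact: LO.
  by move=> [n _]; apply.
apply: srU => n; apply: sub_gen_smallest; exists (F n) => w w' ww' wO w'' ww''.
by apply: wO; exact: agree_trans ww' ww''.
Qed.

End BorelCylinder.

(** * Counting by injections and by a union bound *)

Section Counting.
Local Open Scope nat_scope.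
Variables (T : eqType) (I : Type).

Lemma leq_count_inj (s : seq T) (p q : pred T) (f : T -> T) :
  uniq s -> {in p &, injective f} ->
  (forall w, w \in s -> p w -> (f w \in s) && q (f w)) -> count p s <= count q s.
Proof.
move=> us fI fpq; rewrite -!size_filter -(size_map f (seq.filter p s)).
apply: uniq_leq_size.
  rewrite map_inj_in_uniq ?filter_uniq // => x y.
  by rewrite !mem_filter => /andP[px _] /andP[py _]; exact: fI.
move=> _ /mapP[w + ->]; rewrite !mem_filter => /andP[pw ws].
by have /andP[-> ->] := fpq _ ws pw.
Qed.

Lemma leq_count_has (s : seq T) (L : seq I) (p : pred T) (q : I -> pred T) :
  (forall w, w \in s -> p w -> has (fun h => q h w) L) ->
  count p s <= \sum_(h <- L) count (q h) s.
Proof.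
elim: s => [|w s IHs] pq //=.
rewrite big_split leq_add ?IHs //; last first.
  by move=> w' w's; apply: pq; rewrite inE w's orbT.
case: (boolP (p w)) => // pw; have {pq} := pq w (mem_head _ _) pw.
elim: L {IHs} => //= h L IHL; rewrite big_cons => /orP[->//|/IHL].
by move=> /leq_trans; apply; exact: leq_addl.
Qed.

End Counting.

(** * From counting trees to probabilities in the limit *)

Section WeakLimit.
Variables (R : realType) (G : sgraph) (S : nat -> set (config G)).
Variable P : probability (borel (config G)) R.
Hypothesis SP : uniform_weak_limit S P.

Lemma uniform_mean_indic_cvg (C : set (borel (config G))) : cylinder C ->
  (uniform_mean (S n) (\1_C : config G -> R))%:E @[n --> \oo] --> P C.
Proof.
move=> cC; have mC := measurable_cylinder cC.
rewrite -[P C](_ : (\int[P]_w (\1_C w)%:E)%E = _); last first.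
  by rewrite integral_indic // setIT.
apply: SP; first exact: continuous_indic_cylinder.
by exists 1 => w; rewrite indicE; case: (_ \in _); rewrite ?normr1 // normr0.
Qed.

(** The mean of the constant 1 tends to 1, while it is 0 when [fset_set] is empty. As [fset_set] is
    also empty for infinite sets, this yields finiteness of [S n] as well. *)
Lemma uniform_weak_limit_neq0 : \forall n \near \oo, fset_set (S n) != fset0.
Proof.
have := @uniform_mean_indic_cvg setT.
rewrite probability_setT => /(_ (ex_intro _ [::] (@determinedT _ _))).
move=> /fine_cvgP[_ /cvgrPdist_lt/(_ 1 ltr01)]; apply: filterS => n /=.
apply: contraTneq => S0; rewrite /uniform_mean S0 cardfs0 invr0 mulr0 subr0.
by rewrite normr1 ltxx.
Qed.

Lemma uniform_mean_indic (A C : set (config G)) : fset_set A != fset0 ->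
  uniform_mean A (\1_C : config G -> R) =
  (count (mem C) (fset_set A))%:R / (#|` fset_set A|)%:R.
Proof.
move=> A0; have fA : finite_set A.
  by move: A0; rewrite /fset_set; case: pselect => //; rewrite eqxx.
rewrite /uniform_mean fsbig_finite //=; congr (_ / _).
rewrite -sum1_count natr_sum [RHS]big_mkcond; apply: eq_bigr => w _.
by rewrite indicE /=; case: (w \in C).
Qed.

(** The counting inequality is divided by the size of [S n] and [n] tends to infinity. *)
Lemma uniform_weak_limit_le (I : Type) (L : seq I) (C : set (borel (config G)))
    (Z : I -> set (borel (config G))) :
  cylinder C -> (forall h, cylinder (Z h)) ->
  (\forall n \near \oo, (count (mem C) (fset_set (S n)) <=
    \sum_(h <- L) count (mem (Z h)) (fset_set (S n)))%N) ->
  (P C <= \sum_(h <- L) P (Z h))%E.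
Proof.
move=> cC cZ le_n.
have cvgL : (\sum_(h <- L) (uniform_mean (S n) (\1_(Z h) : config G -> R))%:E)%E
    @[n --> \oo] --> (\sum_(h <- L) P (Z h))%E.
  apply: cvg_nnesum => h _; last exact: uniform_mean_indic_cvg.
  near=> n; rewrite uniform_mean_indic ?lee_fin ?divr_ge0 //.
  by near: n; exact: uniform_weak_limit_neq0.
apply: (lee_cvg_to (uniform_mean_indic_cvg cC) cvgL).
near=> n; have Sn0 : fset_set (S n) != fset0.
  by near: n; exact: uniform_weak_limit_neq0.
rewrite sumEFin lee_fin uniform_mean_indic //.
under eq_bigr => h _ do rewrite uniform_mean_indic //.
rewrite -mulr_suml ler_pM2r ?invr_gt0 ?ltr0n ?cardfs_gt0 // -natr_sum ler_nat.
by near: n.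
Unshelve. all: by end_near. Qed.

End WeakLimit.

(** * Finite measures and monotone classes *)

Section FiniteMeasureOf.
Context d (T : measurableType d) (R : realType).
Variable nu : {measure set T -> \bar R}.

(** A copy of [nu] that carries the proof of finiteness, to which the structure of a finite measure
    is attached. *)
Definition finite_measure_of (fnu : fin_num_fun nu) : set T -> \bar R := nu.

Hypothesis fnu : fin_num_fun nu.

HB.instance Definition _ := isMeasure.Build _ _ _ (finite_measure_of fnu)
  (measure0 nu) (measure_ge0 nu) (@measure_semi_sigma_additive _ _ _ nu).

HB.instance Definition _ :=
  Measure_isFinite.Build _ _ _ (finite_measure_of fnu) fnu.

End FiniteMeasureOf.

Section FiniteMeasures.
Context d (T : measurableType d) (R : realType).
Local Open Scope ereal_scope.

(** Both sides are continuous along monotone sequences; finiteness enters for the decreasing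
    ones. *)
Lemma monotone_measure_le (I : Type) (L : seq I)
    (mu : {finite_measure set T -> \bar R})
    (nu : I -> {finite_measure set T -> \bar R}) :
  monotone [set A | measurable A /\ mu A <= \sum_(h <- L) nu h A].
Proof.
split=> F mF FM.
  have mFi i : measurable (F i) := (FM i).1.
  have mUF : measurable (\bigcup_i F i) by exact: bigcupT_measurable.
  split=> //; apply: (lee_cvg_to (nondecreasing_cvg_mu mFi mUF mF)).
    apply: cvg_nnesum => [h _|h _]; last exact: nondecreasing_cvg_mu.
    by near=> n; exact: measure_ge0.
  by apply: nearW => n; exact: (FM n).2.
have mFi i : measurable (F i) := (FM i).1.
have mUF : measurable (\bigcap_i F i) by exact: bigcapT_measurable.
have fin (m : {finite_measure set T -> \bar R}) : m (F 0%N) < +oo.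
  by rewrite ltey_eq fin_num_measure.
split=> //; apply: (lee_cvg_to (nonincreasing_cvg_mu (fin _) mFi mUF mF)).
  apply: cvg_nnesum => [h _|h _]; last exact: (nonincreasing_cvg_mu (fin _)).
  by near=> n; exact: measure_ge0.
by apply: nearW => n; exact: (FM n).2.
Unshelve. all: by end_near. Qed.

Lemma pushforward_restr (mu : {finite_measure set T -> \bar R}) (f : T -> T)
    (V : set T) : measurable_fun setT f -> measurable V ->
  exists nu : {finite_measure set T -> \bar R},
    forall A, nu A = mu (f @^-1` A `&` V).
Proof.
move=> mf mV.
pose nu_of := pushforward (mrestr mu mV) f : {measure set T -> \bar R}.
pose nu := nu_of mf.
have fnu : fin_num_fun nu.
  move=> A mA; have := mf measurableT A mA; rewrite setTI => mfA.
  exact: (fin_num_measure (mrestr mu mV)).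
by exists (finite_measure_of fnu).
Qed.

End FiniteMeasures.

(** * The exchange map and the images of events under it *)

Section Exchange.
Variable G : sgraph.
Implicit Types (w : config G) (e h : edge G) (L : seq (edge G)).
Implicit Types (A B : set G) (C : set (config G)).

(** Exchanging back gives the injectivity used in the counting, and turns images of events into
    preimages. *)
Lemma ins_delK e h w : ~ w e -> w h -> ins_del h (Some e) (ins_del e (Some h) w) = w.
Proof.
move=> we wh; apply/funext => g; rewrite /ins_del.
have eqS (a b : edge G) : (Some a == Some b) = (a == b) by [].
rewrite !eqS; have [->|ge] := eqVneq g e.
  by rewrite andbF; apply/esym/negbTE/negP.
have [->|gh] := eqVneq g h; first by rewrite orbT wh.
by rewrite !orbF !andbT.
Qed.

Lemma ins_del_ins e h w : ~ w e -> w h -> ins_del e (Some h) w e.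
Proof.
move=> we wh; rewrite /ins_del eqxx orbT /=; apply/eqP => -[eh].
by rewrite eh in we.
Qed.

Lemma ins_del_del e h w : ~ ins_del e (Some h) w h.
Proof. by rewrite /ins_del eqxx andbF. Qed.

Lemma agree_ins_del L e (f : option (edge G)) w w' :
  agree L w w' -> agree L (ins_del e f w) (ins_del e f w').
Proof. by move=> ww' g gL; rewrite /ins_del ww'. Qed.

(* The image of [C] intersected with [exits B e x h] under [ins_del e (Some h)]. *)
Definition exchanged B e x h C : set (config G) :=
  ins_del h (Some e) @^-1` C `&`
  [set w : config G | [/\ w e, ~ w h & exits B e x h (ins_del h (Some e) w)]].

Lemma exchangedP B e x h C w :
  C w -> exits B e x h w -> exchanged B e x h C (ins_del e (Some h) w).
Proof.
move=> Cw Ew; have [we [wh _]] := Ew; rewrite /exchanged /= ins_delK //.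
by split=> //; split=> //; [exact: ins_del_ins|exact: ins_del_del].
Qed.

Lemma exchanged_sub B e x h C (w : config G) : exchanged B e x h C w ->
  exists w', [/\ C w', exits B e x h w' & w = ins_del e (Some h) w'].
Proof.
move=> [Cw [we wh Ew]]; exists (ins_del h (Some e) w); split=> //.
by rewrite ins_delK.
Qed.

Lemma determined_inside_linked L B x y :
  (forall h, (forall v, v \in val h -> B v) -> h \in L) ->
  determined L [set w | inside_linked B w x y].
Proof.
move=> BL w w' ww'; apply: sub_linked => h [wh Bh]; split=> //=.
by rewrite -ww' // BL.
Qed.

Lemma determined_exits L B e x h :
  (forall h, (forall v, v \in val h -> B v) -> h \in L) ->
  determined (e :: h :: L) (exits B e x h).
Proof.
move=> BL w w' ww' [we [wh [a [b [hab Ba nBb xa]]]]]; split.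
  by rewrite -ww' ?mem_head.
split; first by rewrite -ww' // !inE eqxx orbT.
exists a, b; split=> //; apply: (determined_inside_linked BL _ xa).
by apply: sub_agree ww' => g gL; rewrite !inE gL !orbT.
Qed.

Lemma cylinder_exchanged L B e x h C :
  (forall h, (forall v, v \in val h -> B v) -> h \in L) ->
  cylinder C -> cylinder (exchanged B e x h C).
Proof.
move=> BL [L' LC]; exists (e :: h :: L ++ L') => w w' ww' [Cw [we wh Ew]].
have ww'' := agree_ins_del h (Some e) ww'.
split.
  apply: LC Cw; apply: sub_agree ww'' => g gL'.
  by rewrite !inE mem_cat gL' !orbT.
split; first by rewrite -ww' ?mem_head.
  by rewrite -ww' // !inE eqxx orbT.
apply: (determined_exits BL _ Ew); apply: sub_agree ww'' => g.
by rewrite !inE mem_cat => /orP[->//|/orP[->|->]]; rewrite ?orbT.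
Qed.

End Exchange.

(** * Exhaustions and countability of the edge set *)

Section Exhaustion.
Variables (G : sgraph) (H : nat -> subgraph G).
Hypothesis exH : exhaustion H.

Lemma exhaustion_mono m n : (m <= n)%N ->
  sub_verts (H m) `<=` sub_verts (H n) /\ sub_edges (H m) `<=` sub_edges (H n).
Proof.
have [_ mH _ _] := exH; elim: n => [|n IHn].
  by rewrite leqn0 => /eqP ->; split.
rewrite leq_eqVlt => /orP[/eqP ->|/IHn[V1 E1]]; first by split.
by have [V2 E2] := mH n; split; [exact: subset_trans V2|exact: subset_trans E2].
Qed.

(** [F n] lists all edges between vertices of [H n]. A finite list of edges is contained in one
    [H n] because the exhaustion is increasing. *)
Lemma exhaustion_edges : exists F : nat -> seq (edge G),
  forall L : seq (edge G), exists n, {subset L <= F n}.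
Proof.
have [finH _ _ covE] := exH.
pose V n : seq G := fset_set (sub_verts (H n)).
exists (fun n => pmap (fun p : G * G => insub [fset p.1; p.2]%fset)
  [seq (a, b) | a <- V n, b <- V n]) => L.
suff [n Ln] : exists n, forall e, e \in L -> sub_edges (H n) e.
  exists n => e /Ln He; have [a [b [_ hab]]] := set_mem (valP e).
  have [finV _ endsV _] := finH n.
  have VP z z' : ends e z z' -> z \in V n.
    by move=> ezz'; rewrite /V in_fset_set // inE; exact: endsV ezz'.
  rewrite mem_pmap; apply/mapP; exists (a, b); last by rewrite /= -hab valK.
  apply/allpairsP; exists (a, b); split=> //=; first exact: VP hab.
  by apply: (VP b a); rewrite /ends fsetUC.
elim: L => [|e L [n IHL]]; first by exists 0%N.
have [m _ Hm] : (\bigcup_n sub_edges (H n)) e by rewrite covE.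
exists (maxn m n) => g; rewrite inE => /orP[/eqP ->|/IHL].
  exact: (exhaustion_mono (leq_maxl _ _)).2.
exact: (exhaustion_mono (leq_maxr _ _)).2.
Qed.

End Exhaustion.

(** * The exchange inequality for limits of uniform spanning trees *)

Section ExchangeInequality.
Variables (R : realType) (G : sgraph).
Variable P : probability (borel (config G)) R.

(* The projection [i n] is [id] in the free case and [wire (H n)] in the wired
   case. *)
Definition forest_limit : Prop :=
  exists (H : nat -> subgraph G) (W : choiceType) (i : nat -> G -> W)
    (VS : nat -> set W) (ES : nat -> set (edge G)),
  [/\ exhaustion H,
      uniform_weak_limit (fun n => [set w : config G |
        spanning_tree (proj_ends (i n)) (VS n) (ES n) [set g | w g]]) P,
      forall n u v, sub_verts (H n) u -> i n u = i n v -> u = v,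
      forall n u, sub_verts (H n) u -> VS n (i n u) &
      forall n, sub_edges (H n) `<=` ES n].

Lemma FUSF_forest_limit : is_FUSF P -> forest_limit.
Proof.
move=> [H exH SP]; exists H, G, (fun=> id), (fun n => sub_verts (H n)),
  (fun n => sub_edges (H n)).
split=> [//||//|//|n g //].
by move: SP; rewrite /free_trees -proj_ends_id; exact.
Qed.

Lemma WUSF_forest_limit : is_WUSF P -> forest_limit.
Proof.
move=> [H exH SP]; exists H, (option G), (fun n => wire (H n)),
  (fun n => wired_verts (H n)), (fun n => wired_edges (H n)).
split=> // n u => [v Hu|Hu|].
- rewrite /= /wire mem_set //; case: ifP => // _ [].
  by [].
- by left; exists u => //; rewrite /= /wire mem_set.
- by left.
Qed.

Hypothesis limP : forest_limit.
Variables (B : set G) (e : edge G) (x y : G).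
Variables (bs : seq G) (es : seq (edge G)).
Hypothesis Bbs : forall a, B a -> a \in bs.
Hypothesis Bes : forall a b h, B a -> ends h a b -> h \in es.
Hypotheses (exy : ends e x y) (Bx : B x) (By : B y).

Let insideL : forall h, (forall v, v \in val h -> B v) -> h \in es.
Proof.
move=> h Bh; have [a [b [ab hab]]] := set_mem (valP h).
by apply: (@Bes a b h) => //; apply: Bh; rewrite hab !inE eqxx.
Qed.

(** For large [n] the graph [H n] contains [e] and [B]. Then [tree_exit] assigns an exit edge [h] in
    [es] to each tree of [C] that does not join [x] to [y] inside [B], and for fixed [h] the
    exchange maps these trees injectively to trees in [exchanged B e x h C]. *)
Lemma exchange_cylinder_le C : cylinder C ->
  (P (C `\` [set w : config G | inside_linked B w x y]) <=
   \sum_(h <- es) P (exchanged B e x h C : set (borel (config G))))%E.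
Proof.
move: limP => [H [W [i [VS [ES [exH SP iH VSH ESH]]]]]] cC.
move: SP; set S := (fun n => _) => SP; have [_ _ covV covE] := exH.
have nearV v : \forall n \near \oo, sub_verts (H n) v.
  have [m _ Hm] : (\bigcup_n sub_verts (H n)) v by rewrite covV.
  by exists m => // n /= mn; exact: (exhaustion_mono exH mn).1.
have nearE : \forall n \near \oo, sub_edges (H n) e.
  have [m _ Hm] : (\bigcup_n sub_edges (H n)) e by rewrite covE.
  by exists m => // n /= mn; exact: (exhaustion_mono exH mn).2.
have nearB : \forall n \near \oo, forall a, B a -> sub_verts (H n) a.
  have : \forall n \near \oo, forall a, a \in bs -> sub_verts (H n) a.
    elim: bs => [|a s IHs]; first by apply: nearW.
    by apply: filterS2 (nearV a) IHs => n Ha Hs b; rewrite inE => /orP[/eqP ->|/Hs].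
  by apply: filterS => n Hbs a /Bbs; exact: Hbs.
apply: (uniform_weak_limit_le SP).
- have [_ _ rD] := @setring_cylinder G; apply: rD => //.
  by exists es; exact: determined_inside_linked.
- by move=> h; exact: (cylinder_exchanged _ _ _ insideL cC).
have near0 := uniform_weak_limit_neq0 SP.
near=> n; have Sn0 : fset_set (S n) != fset0 by near: n.
have Sin w : (w \in fset_set (S n)) = (w \in S n).
  apply: in_fset_set; move: Sn0.
  by rewrite /fset_set; case: pselect => //; rewrite eqxx.
have HB : forall a, B a -> sub_verts (H n) a by near: n.
have He : sub_edges (H n) e by near: n.
(* The trees for which exchanging [h] is possible and gives a tree again; a tree may be counted for
   several [h]. *)
pose q h := [pred w : config G | (w \in C `&` exits B e x h) &&
  (ins_del e (Some h) w \in S n)].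
apply: leq_trans (leq_count_has (L := es) (q := q) _) _.
  move=> w; rewrite Sin => /set_mem Sw /set_mem[Cw nw].
  have [h [Eh Sh]] := tree_exit (fun u v Bu => iH n u v (HB u Bu))
    (VSH _ _ (HB _ Bx)) (VSH _ _ (HB _ By)) exy (ESH _ _ He) Bx By Sw nw.
  apply/hasP; exists h; first by have [_ [_ [a [b [hab Ba _ _]]]]] := Eh; exact: Bes hab.
  by rewrite /q /=; apply/andP; split; apply/mem_set.
apply: leq_sum => h _; apply: (leq_count_inj (f := ins_del e (Some h))).
- exact: fset_uniq.
- move=> w w' /andP[/set_mem[_ [we [wh _]]] _] /andP[/set_mem[_ [we' [wh' _]]] _] E.
  by rewrite -(ins_delK we wh) E ins_delK.
- move=> w _ /andP[/set_mem[Cw Ew] Sw]; rewrite Sin Sw /=.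
  by apply/mem_set; exact: exchangedP.
Unshelve. all: by end_near. Qed.

(** By injectivity of the exchange, the probability of the image is a measure in [A]: restrict [P]
    to the possible images, then push it forward along the inverse exchange. *)
Lemma exchanged_measure h : exists nu : {finite_measure set (borel (config G)) -> \bar R},
  forall A, nu A = P (exchanged B e x h A).
Proof.
apply: pushforward_restr; first exact: measurable_ins_del.
have := cylinder_exchanged e x h insideL (ex_intro _ [::] (@determinedT G _)).
by move=> /measurable_cylinder; rewrite /exchanged preimage_setT setTI.
Qed.

(** Both sides are finite measures in [A], the left one being a restriction of [P], so the
    inequality extends from cylinders by monotone classes. *)
Lemma exchange_le (A : set (borel (config G))) : measurable A ->
  (P (A `\` [set w : config G | inside_linked B w x y]) <=
   \sum_(h <- es) P (exchanged B e x h A : set (borel (config G))))%E.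
Proof.
have [H [_ [_ [_ [_ [exH _ _ _ _]]]]]] := limP.
have [F FL] := exhaustion_edges exH.
have [nu nuE] := choice exchanged_measure.
pose D := [set w : config G | inside_linked B w x y] : set (borel (config G)).
have mD : measurable D.
  by apply: measurable_cylinder; exists es; exact: determined_inside_linked.
move=> mA.
have [_] : measurable A /\ (mrestr P (measurableC mD) A <= \sum_(h <- es) nu h A)%E.
  apply: (borel_cylinder_ind FL
    (monotone_measure_le es (mrestr P (measurableC mD)) nu) _ mA) => C cC.
  split; first exact: measurable_cylinder.
  have := exchange_cylinder_le cC; rewrite setDE => /le_trans; apply.
  by under eq_bigr do rewrite -nuE.
rewrite setDE => /le_trans; apply.
by under eq_bigr do rewrite nuE.
Qed.

End ExchangeInequality.

(** * Measurable selection by Hahn decomposition *)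

Section Selection.
Context d (T : measurableType d) (R : realType).
Local Open Scope ereal_scope.

(** [Q] is the positive set of the charge [nu - c * mu], that is, where [nu] has density at least
    [c] with respect to [mu]. *)
Lemma Hahn_measure_le (mu nu : {finite_measure set T -> \bar R}) (c : R) :
  exists Q : set T, [/\ measurable Q,
    forall A, measurable A -> A `<=` Q -> c%:E * mu A <= nu A &
    forall A, measurable A -> A `<=` ~` Q -> nu A <= c%:E * mu A].
Proof.
pose mu' := cscale (- c)%R (charge_of_finite_measure mu).
have [Q [N [[mQ posQ] [mN negN] QN _]]] :=
  Hahn_decomposition (cadd (charge_of_finite_measure nu) mu').
have cmu A : measurable A -> c%:E * mu A \is a fin_num.
  by move=> mA; rewrite fin_numM // fin_num_measure.
have E A : cadd (charge_of_finite_measure nu) mu' A = nu A - c%:E * mu A.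
  by rewrite /cadd /= /mu' /cscale EFinN mulNe.
exists Q; split=> // A mA AQ.
  by rewrite -sube_ge0 ?cmu // -E; exact: posQ.
have AN : A `<=` N.
  by move=> w Aw; have : [set: T] w by []; rewrite -QN => -[/(AQ _ Aw)|].
by rewrite -sube_le0 -E; exact: negN.
Qed.

(** On [F h] the first index of [h :: L] is [h]; off [F h] it is decided by [L]. *)
Lemma measurable_first (I : eqType) (L : seq I) (F : I -> set T) (o : option I) :
  (forall h, measurable (F h)) ->
  measurable [set w | ohead [seq h <- L | `[< F h w >]] = o].
Proof.
move=> mF; elim: L => [|h L IHL] /=.
  case: o => [h|].
    by rewrite (_ : [set _ | _] = set0) //; apply/seteqP; split.
  by rewrite (_ : [set _ | _] = setT) //; apply/seteqP; split.
rewrite (_ : [set _ | _] = (F h `&` [set w | Some h = o]) `|`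
    ([set w | ohead [seq h <- L | `[< F h w >]] = o] `\` F h)); last first.
  apply/seteqP; split=> w /=; case: asboolP => Fw /=; auto.
  - by move=> [[]|[]].
  - by move=> [[]|[]].
apply: measurableU; last exact: measurableD.
apply: measurableI => //.
have [<-|ho] := eqVneq (Some h) o.
  by rewrite (_ : [set _ | _] = setT) //; apply/seteqP; split.
rewrite (_ : [set _ | _] = set0) //; apply/seteqP; split=> // w /= /eqP.
by rewrite (negbTE ho).
Qed.

Lemma measure_le_sum (mu : {measure set T -> \bar R}) (I : eqType) (L : seq I)
    (F : I -> set T) (A N : set T) :
  (forall h, measurable (F h)) -> measurable A -> measurable N ->
  (forall w, A w -> N w \/ exists2 h, h \in L & F h w) ->
  mu A <= mu N + \sum_(h <- L) mu (A `&` F h).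
Proof.
move=> mF + mN; elim: L A => [|h L IHL] A mA AN.
  rewrite big_nil adde0 le_measure ?inE // => w /AN[//|[]].
  by [].
rewrite big_cons -{1}(setUIDK A (F h)).
apply: le_trans (measureU2 _ _ _) _; [exact: measurableI|exact: measurableD|].
rewrite addeCA leeD2l //.
have mAF : measurable (A `\` F h) by exact: measurableD.
apply: le_trans (IHL _ mAF _) _.
  move=> w [Aw nFw]; have [|[g]] := AN w Aw; first by left.
  by rewrite inE => /orP[/eqP -> //|gL Fg]; right; exists g.
rewrite leeD2l // lee_sum // => g _; rewrite le_measure ?inE //.
- by apply: measurableI.
- by apply: measurableI.
- by apply: setSI; exact: subDsetl.
Qed.

(* On the set where no [nu h] has density at least [1 / K.+1] with respect to
   [P], the hypothesis gives [P A <= K / K.+1 * P A], so that [P A = 0]. *)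
Lemma measurable_selection (I : eqType) (L : seq I) (K : nat) (D : set T)
    (P : {finite_measure set T -> \bar R})
    (nu : I -> {finite_measure set T -> \bar R}) (E : I -> set T) :
  (size L <= K)%N -> measurable D -> (forall h, measurable (E h)) ->
  (forall h A, measurable A -> nu h A = nu h (A `&` E h)) ->
  (forall A, measurable A -> P (A `\` D) <= \sum_(h <- L) nu h A) ->
  exists f : T -> option I,
    [/\ forall o, measurable [set w | f w = o],
      forall w h, f w = Some h -> h \in L /\ E h w,
      P ([set w | f w = None] `\` D) = 0 &
      forall h A, measurable A -> A `<=` [set w | f w = Some h] ->
        P A <= K.+1%:R%:E * nu h A].
Proof.
move=> LK mD mE nuE PD.
(* Any [c] with [K * c < 1] forces the set without a selected index to be null outside [D]; this one
   gives the factor [K.+1] in the conclusion. *)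
pose c : R := (K.+1%:R^-1)%R.
have [Q QP] := choice (fun h => Hahn_measure_le P (nu h) c).
have mQE h : measurable (Q h `&` E h) by have [mQ _ _] := QP h; exact: measurableI.
pose f w := ohead [seq h <- L | `[< (Q h `&` E h) w >]].
have fS w h : f w = Some h -> h \in L /\ (Q h `&` E h) w.
  move=> fw; have : h \in [seq h <- L | `[< (Q h `&` E h) w >]].
    by move: fw; rewrite /f; case: [seq _ <- _ | _] => //= h' s [->]; exact: mem_head.
  by rewrite mem_filter => /andP[/asboolP QEw hL].
have fN w h : f w = None -> h \in L -> ~ (Q h `&` E h) w.
  move=> fw hL QEw; have : h \in [seq h <- L | `[< (Q h `&` E h) w >]].
    by rewrite mem_filter hL andbT; apply/asboolP.
  by move: fw; rewrite /f; case: [seq _ <- _ | _].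
exists f; split.
- by move=> o; exact: measurable_first.
- by move=> w h /fS[hL []].
- set N := (X in P X).
  have mN : measurable N by apply: measurableD => //; exact: measurable_first.
  have PN : P N \is a fin_num by exact: fin_num_measure.
  (* [nu h] lives on [E h], and inside [E h] the set [N] avoids [Q h]. *)
  have nuN h : h \in L -> nu h N <= c%:E * P N.
    move=> hL; have [_ _ negQ] := QP h; rewrite nuE //.
    have mNE : measurable (N `&` E h) by exact: measurableI.
    apply: le_trans (negQ _ mNE _) _.
      by move=> w [[/= Nw _] Ew] Qw; exact: (fN w h).
    rewrite lee_pmul2l ?lte_fin ?invr_gt0 //.
    by rewrite le_measure ?inE //; exact: subIsetl.
  have : P N <= (K%:R * c)%:E * P N.
    have := PD N mN; rewrite {1}/N setDDl setUid -/N => /le_trans; apply.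
    have : \sum_(h <- L) nu h N <= \sum_(h <- L) c%:E * P N.
      by rewrite big_seq [leRHS]big_seq; apply: lee_sum.
    move=> /le_trans; apply.
    rewrite -(fineK PN) -EFinM sumEFin -EFinM lee_fin.
    rewrite big_const_seq count_predT iter_addr_0.
    rewrite -[leLHS]mulr_natr [leLHS]mulrC -[leRHS]mulrA.
    have cN0 : (0 <= c * fine (P N))%R.
      by rewrite mulr_ge0 ?fine_ge0 // invr_ge0.
    by apply: ler_wpM2r => //; rewrite ler_nat.
  rewrite -{1 2}(fineK PN) -EFinM lee_fin => PNle.
  rewrite -(fineK PN); congr _%:E; apply/eqP; rewrite eq_le fine_ge0 // andbT.
  move: PNle; rewrite -subr_le0 -{1}[fine _]mul1r -mulrBl pmulr_rle0 //.
  rewrite subr_gt0 /c ltr_pdivrMr // mul1r ltr_nat //.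
- move=> h A mA Af; have [_ posQ _] := QP h.
  have AQ : A `<=` Q h by move=> w /Af/fS[_ []].
  have := posQ A mA AQ; rewrite -(@lee_pmul2l _ K.+1%:R%:E) ?lte_fin //.
  by rewrite muleA -EFinM mulfV ?mul1e.
Qed.

End Selection.

(** * The selected edge for one edge, endpoint and radius *)

Section Selector.
Variables (R : realType) (G : sgraph).
Variable P : probability (borel (config G)) R.

(** The radius [r.+1] keeps both endpoints of [h] out of [gball x r]: if the inner one were there,
    the outer one would be in [gball x r.+1]. *)
Lemma exits_outside (w : config G) e x r h : exits (gball x r.+1) e x h w ->
  edge_of_component_outside w x r h.
Proof.
move=> [_ [wh [a [b [hab _ nBb xa]]]]].
have {}xa : component w x a.
  by apply: sub_linked xa => g [].
have xb : component w x b by apply: linked_trans xa _; exact: linked1 hab.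
split=> // v /(val_ends hab)[]->; split=> //.
  by move=> xra; apply: nBb; exact: gballS hab.
by move=> /sub_gballS.
Qed.

(** Plain insertion is not injective, but its image consists of the configurations containing [e]
    that are in [A] either as they are or after deleting [e], which is what [ins_del e (Some e)]
    does. *)
Lemma measurable_ins_event (e : edge G) (A : set (borel (config G))) :
  measurable A ->
  measurable ([set ins_del e None w | w in A] : set (borel (config G))).
Proof.
move=> mA.
have insE (w : config G) : w e -> ins_del e None w = w.
  move=> we; apply/funext => g; rewrite /ins_del andbT.
  by have [->|] := eqVneq; rewrite ?we ?orbF.
have delK (w : config G) : w e -> ins_del e None (ins_del e (Some e) w) = w.
  move=> we; apply/funext => g; rewrite /ins_del andbT.
  have eqS (a b : edge G) : (Some a == Some b) = (a == b) by [].
  by rewrite eqS; have [->|] := eqVneq g e; rewrite ?we ?orbT ?orbF ?andbT.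
have insK (w : config G) : ~ w e -> ins_del e (Some e) (ins_del e None w) = w.
  move=> we; apply/funext => g; rewrite /ins_del andbT.
  have eqS (a b : edge G) : (Some a == Some b) = (a == b) by [].
  rewrite eqS; have [->|] := eqVneq g e; last by rewrite !orbF andbT.
  by rewrite andbF; apply/esym/negbTE/negP.
have ins_e (w : config G) : ins_del e None w e.
  by rewrite /ins_del eqxx orbT.
rewrite (_ : [set _ | _ in _] =
    [set w : config G | w e] `&` (A `|` ins_del e (Some e) @^-1` A)).
  apply: measurableI.
    apply: measurable_cylinder; exists [:: e].
    by apply: (@determined1 G _ e true); rewrite inE.
  apply: measurableU => //.
  by have := measurable_ins_del e (Some e) measurableT mA; rewrite setTI.
apply/seteqP; split=> [_ [w Aw <-]|w [we [Aw|Aw]]].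
- split; first exact: ins_e.
  have [we|we] := pselect (w e); first by left; rewrite insE.
  by right; rewrite /preimage /= insK.
- by exists w => //; exact: insE.
- by exists (ins_del e (Some e) w) => //; exact: delK.
Qed.

(** Up to a null set, [A] splits into at most [K] pieces according to [f], each of probability at
    most [K.+1] times that of the image of [A]. The square of [K.+1] exceeds [K * K.+1], which gives
    the strict inequality. *)
Lemma exchange_selector (K : nat) (e : edge G) (x y : G) (r : nat)
    (bs : seq G) (es : seq (edge G)) :
  forest_limit P -> ends e x y -> (size es <= K)%N ->
  (forall a, gball x r.+1 a -> a \in bs) ->
  (forall a b h, gball x r.+1 a -> ends h a b -> h \in es) ->
  exists f : config G -> option (edge G),
  [/\ forall o, measurable ([set w | f w = o] : set (borel (config G))),
      forall w h, f w = Some h -> edge_of_component_outside w x r h &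
      forall A : set (borel (config G)), measurable A -> (0 < P A)%E ->
        {ae P, forall w, A w -> component w x <> component w y} ->
        ((K.+1 ^ 2)%:R^-1%:E * P A < P (ins_del_event e f A))%E].
Proof.
move=> limP exy esK Bbs Bes; set B := gball x r.+1 in Bbs Bes *.
have Bx : B x by exact: gball_center.
(* The radius [r.+1] is at least 1, so [y] lies in [B] even for [r = 0]. *)
have By : B y by apply: gballS exy; exact: gball_center.
have BL h : (forall v, v \in val h -> B v) -> h \in es.
  move=> Bh; have [a [b [_ hab]]] := set_mem (valP h).
  by apply: (Bes a b h) => //; apply: Bh; rewrite hab !inE eqxx.
pose T := borel (config G).
pose D := [set w : config G | inside_linked B w x y] : set T.
pose E h := exits B e x h : set T.
have mD : measurable D.
  by apply: measurable_cylinder; exists es; exact: determined_inside_linked.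
have mE h : measurable (E h).
  by apply: measurable_cylinder; exists (e :: h :: es); exact: determined_exits.
have [nu nuE] := choice (exchanged_measure P e x Bes).
have nuI h (A : set T) : measurable A -> nu h A = nu h (A `&` E h).
  move=> _; rewrite !nuE; congr (P _); apply/seteqP; split=> w [Aw [we wh Ew]].
    by split.
  by have [] := Aw.
have le_nu A : measurable A -> (P (A `\` D) <= \sum_(h <- es) nu h A)%E.
  move=> mA; apply: le_trans (exchange_le limP Bbs Bes exy Bx By mA) _.
  by under eq_bigr do rewrite -nuE.
have [f [mf fE fN fS]] := measurable_selection esK mD mE nuI le_nu.
exists f; split=> // [w h /fE[_]|A mA PA0 Anc]; first exact: exits_outside.
pose F h : set T := [set w | f w = Some h].
pose N : set T := [set w | f w = None].
have mAF h : measurable (A `&` F h) by apply: measurableI => //; exact: mf.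
(* Splitting by the value of [f] shows that the image is measurable: each piece is a preimage under
   an inverse exchange, or an image under plain insertion. *)
have evE : ins_del_event e f A =
    \bigcup_(h in [set` es]) exchanged B e x h (A `&` F h) `|`
    [set ins_del e None w | w in A `&` N].
  apply/seteqP; split=> [_ [w Aw <-]|w].
    case fw : (f w) => [h|]; last by right; exists w.
    have [hes Ew] := fE _ _ fw.
    by left; exists h => //; exact: exchangedP.
  case=> [[h _ /exchanged_sub[w' [[Aw' fw'] _ ->]]]|[w' [Aw' Nw'] <-]].
    by exists w' => //; rewrite fw'.
  by exists w' => //; rewrite Nw'.
have mex h : measurable (exchanged B e x h (A `&` F h) : set T).
  apply: measurableI.
    by have := measurable_ins_del h (Some e) measurableT (mAF h); rewrite setTI.
  have := cylinder_exchanged e x h BL (ex_intro _ [::] (@determinedT G _)).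
  by move=> /measurable_cylinder; rewrite /exchanged preimage_setT setTI.
have mev : measurable (ins_del_event e f A).
  rewrite evE; apply: measurableU.
    by apply: fin_bigcup_measurable => [|h _]; [exact: finite_seq|exact: mex].
  by apply: measurable_ins_event; apply: measurableI => //; exact: mf.
have PF h : h \in es -> (P (A `&` F h) <=
    K.+1%:R%:E * P (ins_del_event e f A))%E.
  move=> hes; apply: le_trans (fS h _ (mAF h) _) _; first by move=> w [].
  rewrite nuE lee_pmul2l ?lte_fin //; apply: le_measure; rewrite ?inE //.
  by rewrite evE => w ew; left; exists h.
(* On [D] the vertices [x] and [y] share a component, which almost surely fails on [A]. *)
have PAD : P (A `&` D) = 0%E.
  have [Z [mZ PZ ZA]] := Anc.
  apply/eqP; rewrite eq_le measure_ge0 andbT -PZ le_measure ?inE //.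
    exact: measurableI.
  move=> w [Aw Dw]; apply: ZA => /= /(_ Aw); apply.
  exact: inside_linked_component Dw.
have mAD : measurable (A `&` D) by exact: measurableI.
have mND : measurable (N `\` D) by apply: measurableD => //; exact: mf.
have PN : P ((A `&` D) `|` (N `\` D)) = 0%E.
  apply/eqP; rewrite eq_le measure_ge0 andbT.
  have : (P ((A `&` D) `|` (N `\` D)) <= P (A `&` D) + P (N `\` D))%E.
    exact: measureU2.
  by rewrite PAD add0e fN.
have : (P A <= K%:R%:E * (K.+1%:R%:E * P (ins_del_event e f A)))%E.
  have : (P A <= P ((A `&` D) `|` (N `\` D)) + \sum_(h <- es) P (A `&` F h))%E.
    apply: measure_le_sum => [h|//||w Aw]; first exact: mf.
      exact: measurableU.
    case fw : (f w) => [h|].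
      by right; exists h => //; have [] := fE _ _ fw.
    by left; have [Dw|nDw] := pselect (D w); [left|right].
  rewrite PN add0e => /le_trans; apply.
  have : (\sum_(h <- es) P (A `&` F h) <=
      \sum_(h <- es) K.+1%:R%:E * P (ins_del_event e f A))%E.
    by rewrite big_seq [leRHS]big_seq; apply: lee_sum.
  move=> /le_trans; apply.
  have PI : P (ins_del_event e f A) \is a fin_num by exact: fin_num_measure.
  rewrite -(fineK PI) -EFinM sumEFin -EFinM lee_fin.
  rewrite big_const_seq count_predT iter_addr_0 -[leLHS]mulr_natl.
  by apply: ler_wpM2r; rewrite ?ler_nat // mulr_ge0 // fine_ge0.
have PI : P (ins_del_event e f A) \is a fin_num by exact: fin_num_measure.
have PAf : P A \is a fin_num by exact: fin_num_measure.
move: PA0; rewrite -(fineK PI) -(fineK PAf) -!EFinM !lte_fin lee_fin.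
move: (fine _) (fine _) => i p p0 pi.
have K0 : 0 < (K.+1 ^ 2)%:R :> R by rewrite ltr0n expn_gt0.
rewrite mulrC ltr_pdivrMr //; apply: (le_lt_trans pi).
(* Strictness needs the image to have positive probability, which follows from that of [A]. *)
have i0 : 0 < i.
  rewrite ltNge; apply/negP => i0; move: p0; rewrite ltNge => /negP; apply.
  by apply: (le_trans pi); do 2!apply: mulr_ge0_le0 => //.
rewrite mulrA mulrC ltr_pM2l // -natrM ltr_nat expnS expn1.
by rewrite ltn_mul2r /=.
Qed.

End Selector.

(** * Choice of the witnesses and of a uniform constant *)

Theorem lemma1p3 (R : realType) (G : sgraph)
    (Ginf : infinite_graph G) (Gconn : connected_graph G)
    (Glf : locally_finite G) (Gqt : quasitransitive G) (Guni : unimodular G R)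
    (P : probability (borel (config G)) R) (hP : is_FUSF P \/ is_WUSF P) :
  weakly_insertion_tolerant P /\
  exists2 f : edge G -> G -> nat -> config G -> option (edge G),
    WIT_witness P f &
    forall r : nat, exists2 delta : R, 0 < delta &
      forall (e : edge G) (x y : G) (A : set (borel (config G))),
        ends e x y -> measurable A -> (0 < P A)%E ->
        {ae P, forall w, A w -> component w x <> component w y} ->
        (delta%:E * P A < P (ins_del_event e (f e x r) A))%E.
Proof.
have limP : forest_limit P.
  by case: hP => [/FUSF_forest_limit|/WUSF_forest_limit].
have [K KP] := gball_bound Glf Gqt.
(* The triple [p] is [(e, x, r)]. The second endpoint [y] is determined by [e] and [x]; if [x] is
   not an endpoint of [e], the constant [None] is taken. *)
have sel (p : edge G * G * nat) : exists f : config G -> option (edge G),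
    forall y, ends p.1.1 p.1.2 y ->
  [/\ forall o, measurable ([set w | f w = o] : set (borel (config G))),
      forall w h, f w = Some h -> edge_of_component_outside w p.1.2 p.2 h &
      forall A : set (borel (config G)), measurable A -> (0 < P A)%E ->
        {ae P, forall w, A w -> component w p.1.2 <> component w y} ->
        (((K p.2.+1).+1 ^ 2)%:R^-1%:E * P A < P (ins_del_event p.1.1 f A))%E].
  case: p => -[e x] r /=; have [[y exy]|nexy] := pselect (exists y, ends e x y).
    have [bs [es [esK Bbs Bes]]] := KP r.+1 x.
    have [f fP] := exchange_selector limP exy esK Bbs Bes.
    exists f => y' exy'; suff -> : y' = y by [].
    by have [[_ ->]|[xy ->]] := ends_uniq exy' exy.
  by exists (fun=> None) => y exy; case: nexy; exists y.
have [f fP] := choice sel.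
have wit : WIT_witness P (fun e x r => f (e, x, r)).
  move=> e x y r exy; have [mf fE fA] := fP (e, x, r) y exy; split=> //.
    move=> A mA PA Anc; apply: le_lt_trans (fA A mA PA Anc).
    by apply: mule_ge0; rewrite ?lee_fin ?invr_ge0.
  by apply: aeW => w h; exact: fE.
split; first by exists (fun e x r => f (e, x, r)).
exists (fun e x r => f (e, x, r)) => // r.
(* [K r.+1] bounds the number of edges touching any ball of radius [r.+1], so the constant depends
   on [r] alone. *)
exists ((K r.+1).+1 ^ 2)%:R^-1; first by rewrite invr_gt0 ltr0n expn_gt0.
move=> e x y A exy mA PA Anc; have [_ _ fA] := fP (e, x, r) y exy.
exact: fA.
Qed.
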